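(* Let $d\ge1$, $\lambda>0$, $\delta>0$, and let $f:\mathbb{R}^d\to\mathbb{R}$ satisfy: (A1) $f$ is continuous and has at least one minimizer; (A2) $\int_{\mathbb{R}^d}\exp(-f(y)/\delta)\,dy<+\infty$. Then for every $x\in\mathbb{R}^d$, \[\nabla^2f^{\lambda,\delta}(x)=\frac1\lambda I-\frac{1}{\lambda^2\delta}\Sigma_{\lambda,\delta}(x),\] where $\Sigma_{\lambda,\delta}(x):=\int_{\mathbb{R}^d}(y-\operatorname{zprox}^\delta_{\lambda,f}(x))(y-\operatorname{zprox}^\delta_{\lambda,f}(x))^\top d\mu_x(y)\succeq0$. In particular, if $\Sigma_{\lambda,\delta}(x)\preceq\lambda\delta I$, then $\nabla^2 f^{\lambda,\delta}(x)\succeq 0$ (i.e. $f^{\lambda,\delta}$ is convex at $x$).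
   Context: $\mu_x$ is the probability measure on $\mathbb{R}^d$ with density proportional to $\exp(-f(y)/\delta)\exp(-\|y-x\|^2/(2\lambda\delta))$; its mean is $\operatorname{zprox}^\delta_{\lambda,f}(x)=\dfrac{\mathbb{E}_{y\sim\mathcal N(x,\lambda\delta I)}[y\exp(-f(y)/\delta)]}{\mathbb{E}_{y\sim\mathcal N(x,\lambda\delta I)}[\exp(-f(y)/\delta)]}$. The soft Moreau envelope is $f^{\lambda,\delta}(x)=-\delta\log\mathbb{E}_{y\sim\mathcal N(x,\lambda\delta I)}[\exp(-f(y)/\delta)]$. *)

(* Defs.v *)
From HB Require Import structures.
From mathcomp Require Import all_boot all_order all_algebra.
From mathcomp Require Import all_classical all_reals all_analysis.
Set Implicit Arguments. Unset Strict Implicit. Unset Printing Implicit Defensive.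
Import Order.TTheory GRing.Theory Num.Theory.
Import numFieldNormedType.Exports.
Local Open Scope classical_set_scope.
Local Open Scope ring_scope.

Section Defs.
Variable R : realType.

(* Lebesgue integral over R^n = 'rV[R]_n, computed as the iterated
   integral w.r.t. the one-dimensional Lebesgue measure (Lebesgue measure
   on R^n is the n-fold product of the 1-dimensional one). *)
Fixpoint iint (n : nat) : ('rV[R]_n -> \bar R) -> \bar R :=
  match n with
  | 0 => fun g => g 0
  | m.+1 => fun g =>
      (\int[@lebesgue_measure R]_t
         iint (fun v : 'rV[R]_m => g (row_mx (const_mx t : 'rV[R]_1) v)))%E
  end.

Definition sqnorm n (v : 'rV[R]_n) : R := \sum_(i < n) v 0 i ^+ 2.

Definition gauss_dens n (s : R) (x y : 'rV[R]_n) : R :=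
  (Num.sqrt (2 * pi * s) ^+ n)^-1 * expR (- sqnorm (y - x) / (2 * s)).

Definition gauss_expect n (lam del : R) (x : 'rV[R]_n) (g : 'rV[R]_n -> R) : R :=
  fine (iint (fun y => (g y * gauss_dens (lam * del) x y)%:E)).

Definition soft_moreau n (f : 'rV[R]_n -> R) (lam del : R) (x : 'rV[R]_n) : R :=
  - del * ln (gauss_expect lam del x (fun y => expR (- f y / del))).

Definition zprox n (f : 'rV[R]_n -> R) (lam del : R) (x : 'rV[R]_n) : 'rV[R]_n :=
  \row_i (gauss_expect lam del x (fun y => y 0 i * expR (- f y / del)) /
          gauss_expect lam del x (fun y => expR (- f y / del))).

Definition mu_dens n (f : 'rV[R]_n -> R) (lam del : R) (x y : 'rV[R]_n) : R :=
  expR (- f y / del) * expR (- sqnorm (y - x) / (2 * lam * del)).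

Definition mu_int n (f : 'rV[R]_n -> R) (lam del : R) (x : 'rV[R]_n)
  (g : 'rV[R]_n -> R) : R :=
  fine (iint (fun y => (g y * mu_dens f lam del x y)%:E)) /
  fine (iint (fun y => (mu_dens f lam del x y)%:E)).

Definition Sigma n (f : 'rV[R]_n -> R) (lam del : R) (x : 'rV[R]_n) : 'M[R]_n :=
  \matrix_(i, j) mu_int f lam del x
     (fun y => (y 0 i - zprox f lam del x 0 i) * (y 0 j - zprox f lam del x 0 j)).

Definition grad n (F : 'rV[R]_n -> R) (z : 'rV[R]_n) : 'rV[R]_n :=
  \row_i ('D_(delta_mx 0 i) F z).

Definition psd n (M : 'M[R]_n) : Prop := forall v : 'rV[R]_n, 0 <= (v *m M *m v^T) 0 0.
Definition loewner_le n (A B : 'M[R]_n) : Prop := psd (B - A).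

End Defs.

(* Main.v *)
Require Import Defs.
From HB Require Import structures.
From mathcomp Require Import all_boot all_order all_algebra.
From mathcomp Require Import all_classical all_reals all_analysis.
From mathcomp Require Import ring lra measurable_realfun.
Set Implicit Arguments.
Unset Strict Implicit.
Unset Printing Implicit Defensive.
Import Order.TTheory GRing.Theory Num.Theory.
Import numFieldNormedType.Exports.
Local Open Scope classical_set_scope.
Local Open Scope ring_scope.

(* Expanding |y - x|^2 gives, with s = lam * del,
     f^{lam,del}(x) = |x|^2 / (2 lam) - del * ln (L k x) + constant,
   where L g x is the integral of exp(<x, y> / s) g(y) and
   k(y) = exp(-f(y)/del) exp(-|y|^2/(2s)) has Gaussian decay, f being bounded
   below. Integrating |e^q - 1 - q| <= q^2 e^|q| at q = <h, y> / s shows that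
   L g is Frechet differentiable with i-th partial derivative L (y_i g) / s.
   Two differentiations of ln (L k) produce the covariance of mu_x. *)

(** * Iterated integrals of continuous functions under a Gaussian bound *)

Section Integrals.
Context {R : realType}.
Implicit Types (n : nat) (a C t : R).
Local Notation mu := (@lebesgue_measure R).

(** Since [fine] sends infinite values to 0, [rint] is informative only where the iterated integral
    is finite; Gaussian decay will ensure this. *)
Definition rint n (g : 'rV[R]_n -> R) : R := fine (iint (fun y => (g y)%:E)).

Definition row_cons n t (v : 'rV[R]_n) : 'rV[R]_(1 + n) :=
  row_mx (const_mx t : 'rV[R]_1) v.

Lemma sqnorm_row_cons n t (v : 'rV[R]_n) :
  sqnorm (row_cons t v) = t ^+ 2 + sqnorm v.
Proof.
rewrite /sqnorm big_split_ord/= big_ord1 row_mxEl mxE; congr (_ + _).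
by apply: eq_bigr => i _; rewrite row_mxEr.
Qed.

Lemma sqnorm_ge0 n (v : 'rV[R]_n) : 0 <= sqnorm v.
Proof. by apply: sumr_ge0 => i _; exact: sqr_ge0. Qed.

(** The matrix norm is the maximum of the entries, so finitely many entrywise neighbourhoods
    intersect to one. *)
Lemma continuous_mx (T : topologicalType) m n (F : T -> 'M[R]_(m, n)) :
  (forall i j, continuous (fun x => F x i j)) -> continuous F.
Proof.
move=> cF x; apply/cvgrPdist_lt => e e0.
have : \forall y \near x, forall ij : 'I_m * 'I_n,
    `|F x ij.1 ij.2 - F y ij.1 ij.2| < e.
  apply: filter_forall => -[i j] /=.
  by have /cvgrPdist_lt/(_ _ e0) := cF i j x.
apply: filterS => y Fxy.
rewrite [ltLHS]/Num.norm/= mx_normrE; apply/bigmax_ltP; split=> // ij _.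
by rewrite !mxE; exact: Fxy.
Qed.

Lemma continuous_pair (T U V : topologicalType) (f : T -> U) (g : T -> V) :
  continuous f -> continuous g -> continuous (fun x => (f x, g x)).
Proof. by move=> cf cg x; exact: (cvg_pair (cf x) (cg x)). Qed.

Lemma continuous_row_cons n :
  continuous (fun p : R * 'rV[R]_n => row_cons p.1 p.2).
Proof.
apply: continuous_mx => i j; rewrite -(fintype.splitK j);
  case: (fintype.split j) => k /=.
- rewrite (_ : (fun _ => _) = fst); first by move=> p; exact: cvg_fst.
  by apply/funext => p; rewrite row_mxEl mxE.
- rewrite (_ : (fun _ => _) = (fun v : 'rV[R]_n => v i k) \o snd).
    move=> p; apply: continuous_comp; first exact: cvg_snd.
    exact: coord_continuous.
  by apply/funext => p; rewrite row_mxEr.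
Qed.

(** Continuity belongs to the class because it passes to slices and supplies measurability at each
    level of the iterated integral. *)
Definition gauss_bounded n a C (g : 'rV[R]_n -> R) :=
  continuous g /\ forall y, `|g y| <= C * expR (- a * sqnorm y).

Lemma integrable_gauss a C : 0 < a ->
  mu.-integrable setT (fun t => (C * expR (- a * t ^+ 2))%:E).
Proof.
move=> a0.
(* The standard deviation for which the centered normal density has exponent [- a * t ^+ 2]. *)
pose s := Num.sqrt (a *+ 2)^-1.
have s0 : s != 0 by rewrite gt_eqF// sqrtr_gt0 invr_gt0 mulrn_wgt0.
have -> : (fun t => (C * expR (- a * t ^+ 2))%:E) =
    (fun t => ((C / normal_peak s)%:E * (normal_pdf 0 s t)%:E)%E).
  apply/funext => t; rewrite -EFinM /normal_pdf (negbTE s0) /normal_fun.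
  rewrite subr0 -mulrA mulKf ?gt_eqF ?normal_peak_gt0//.
  rewrite sqr_sqrtr ?invr_ge0 ?mulrn_wge0 ?ltW// -mulr_natr.
  congr (C * expR _)%:E; rewrite -[a *+ 2]mulr_natr; field.
  by rewrite gt_eqF.
exact: integrableZl (integrable_normal_pdf 0 s).
Qed.

Definition gauss_mass a := \int[mu]_t expR (- a * t ^+ 2).

Lemma Rintegral_gauss a C : 0 < a ->
  \int[mu]_t (C * expR (- a * t ^+ 2)) = C * gauss_mass a.
Proof.
move=> a0; rewrite RintegralZl//.
by under [X in integrable _ _ X]funext do rewrite /= -[expR _]mul1r;
  exact: integrable_gauss.
Qed.

(** The Gaussian of a row is the product of the Gaussians of its head and its tail, so a slice keeps
    the rate and only its constant shrinks. *)
Lemma gauss_bounded_row_cons n a C (g : 'rV[R]_(1 + n) -> R) t :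
  gauss_bounded a C g ->
  gauss_bounded a (C * expR (- a * t ^+ 2)) (fun v => g (row_cons t v)).
Proof.
move=> [cg gC]; split.
  move=> v; apply: (@continuous_comp _ _ _ (@row_cons n t)); last exact: cg.
  apply: (@continuous_comp _ _ _ (pair t) (fun p => row_cons p.1 p.2)).
    by apply: continuous_pair => p; [exact: cst_continuous|exact: cvg_id].
  exact: continuous_row_cons.
move=> v; apply: (le_trans (gC _)).
by rewrite sqnorm_row_cons mulrDr expRD mulrA.
Qed.

Lemma gauss_bounded_ge0 n a C (g : 'rV[R]_n -> R) :
  gauss_bounded a C g -> 0 <= C.
Proof.
move=> [_ /(_ 0) /(le_trans (normr_ge0 _))].
by rewrite pmulr_lge0// expR_gt0.
Qed.

(** Bounding the factor [expR (- a * t ^+ 2)] by 1 gives one constant for all slices, as the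
    continuity statement in a parameter requires. *)
Lemma gauss_bounded_row_cons_le n a C (g : 'rV[R]_(1 + n) -> R) t : 0 < a ->
  gauss_bounded a C g -> gauss_bounded a C (fun v => g (row_cons t v)).
Proof.
move=> a0 gC; have [cgt gtC] := gauss_bounded_row_cons t gC; split=> // y.
apply: (le_trans (gtC y)); rewrite ler_pM2r ?expR_gt0//.
rewrite ler_piMr ?(gauss_bounded_ge0 gC)// -expR0 ler_expR mulNr oppr_le0.
by rewrite mulr_ge0 ?sqr_ge0// ltW.
Qed.

Lemma integrable_gauss_bounded a C (G : R -> R) : 0 < a -> continuous G ->
  (forall t, `|G t| <= C * expR (- a * t ^+ 2)) ->
  mu.-integrable setT (EFin \o G).
Proof.
move=> a0 cG GC; apply: le_integrable (integrable_gauss C a0) => //.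
  by apply/measurable_EFinP; exact: continuous_measurable_fun.
by move=> t _ /=; rewrite lee_fin (le_trans (GC t))// ler_norm.
Qed.

(* The two parts are proved together: in dimension n + 1 the slice integral must
   be continuous, hence measurable, for the outer integral to be controlled. *)
Lemma iint_gauss_bounded n a : 0 < a ->
  (forall C (g : 'rV[R]_n -> R), gauss_bounded a C g ->
     iint (fun y => (g y)%:E) \is a fin_num /\
     `|rint g| <= C * gauss_mass a ^+ n) /\
  (forall C (h : R -> 'rV[R]_n -> R),
     continuous (fun p : R * 'rV[R]_n => h p.1 p.2) ->
     (forall t, gauss_bounded a C (h t)) ->
     continuous (fun t => rint (h t))).
Proof.
move=> a0; elim: n => [|n [IHb IHc]].
  split=> [C g [cg gC]|C h ch hC].
    split=> //; rewrite /rint/= mulr1 (le_trans (gC 0))//.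
    by rewrite /sqnorm big_ord0 mulr0 expR0 mulr1.
  move=> t; apply: (@continuous_comp _ _ _ (pair^~ (0 : 'rV[R]_0))
    (fun p => h p.1 p.2)).
    by apply: continuous_pair => p; [exact: cvg_id|exact: cst_continuous].
  exact: ch.
(* Integrating out the tail leaves a function of the head that is continuous by the second induction
   hypothesis and Gaussian-bounded by the first; both halves of the induction step rest on it. *)
have slice C (g : 'rV[R]_(1 + n) -> R)
    (G := fun t => rint (fun v => g (row_cons t v))) :
    gauss_bounded a C g ->
    [/\ iint (fun y => (g y)%:E) = (\int[mu]_t (G t)%:E)%E,
       mu.-integrable setT (EFin \o G) &
       forall t, `|G t| <= (C * gauss_mass a ^+ n) * expR (- a * t ^+ 2)].
  move=> gC.
  have Gle t : `|G t| <= (C * gauss_mass a ^+ n) * expR (- a * t ^+ 2).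
    have [_] := IHb _ _ (gauss_bounded_row_cons t gC).
    by rewrite mulrAC.
  split => //.
    apply: eq_integral => t _ /=; rewrite fineK//.
    by have [] := IHb _ _ (gauss_bounded_row_cons t gC).
  apply: (integrable_gauss_bounded a0 _ Gle).
  apply: (IHc C (fun t v => g (row_cons t v))).
    move=> p; apply: continuous_comp; first exact: continuous_row_cons.
    by have [cg _] := gC; exact: cg.
  by move=> t; exact: gauss_bounded_row_cons_le.
split=> [C g /slice[E intG Gle]|C h ch hC].
  split; first by rewrite E integrable_fin_num.
  rewrite /rint E; apply: le_trans; first exact: le_normr_Rintegral.
  rewrite exprSr mulrA -Rintegral_gauss//; apply: le_Rintegral => //.
  - exact: integrable_norm.
  - exact: integrable_gauss.
pose H s t := rint (fun v => h s (row_cons t v)).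
have HE s : rint (h s) = \int[mu]_t H s t.
  by have [E _ _] := slice _ _ (hC s); rewrite /rint E.
under [X in continuous X]funext do rewrite HE.
move=> s.
(* Continuity at [s] is local, so a bounded interval around [s] suffices. The majorant of [H x t] is
   a Gaussian in [t] that does not depend on [x]. *)
have := @continuity_under_integral R _ _ mu H setT measurableT (s - 1) (s + 1).
apply => //=.
- by move=> x _; have [] := slice _ _ (hC x).
- apply/aeW => t _ x _; apply: (IHc C (fun x v => h x (row_cons t v))).
    move=> p; apply: (@continuous_comp _ _ _
      (fun p : R * 'rV[R]_n => (p.1, row_cons t p.2)) (fun p => h p.1 p.2)).
      apply: continuous_pair => q; first exact: cvg_fst.
      apply: (@continuous_comp _ _ _ (fun p : R * 'rV[R]_n => (t, p.2))
        (fun p => row_cons p.1 p.2)).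
        by apply: continuous_pair => r; [exact: cst_continuous|exact: cvg_snd].
      exact: continuous_row_cons.
    exact: ch.
  by move=> s'; exact: gauss_bounded_row_cons_le.
- exact: (integrable_gauss (C * gauss_mass a ^+ n) a0).
- by move=> x _; apply: aeW => t _; have [_ _] := slice _ _ (hC x); exact.
- by rewrite inE/= in_itv/= ltrDl ltrBlDr ltrDl ltr01.
Qed.

End Integrals.

(** * Functions with Gaussian decay: closure properties, linearity and positivity of the integral *)

Section GaussDecay.
Context {R : realType}.
Implicit Types (n : nat) (a b C c t : R).
Local Notation mu := (@lebesgue_measure R).

(** Rate and constant are existential because products with exponentials change both. *)
Definition gauss_decay n (g : 'rV[R]_n -> R) :=
  exists a C, 0 < a /\ gauss_bounded a C g.

Lemma iint_rint n (g : 'rV[R]_n -> R) :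
  gauss_decay g -> iint (fun y => (g y)%:E) = (rint g)%:E.
Proof.
by move=> [a [C [a0 gC]]]; rewrite fineK//;
  have [+ _] := iint_gauss_bounded n a0 => /(_ _ _ gC) [].
Qed.

Lemma gauss_decay_row_cons n (g : 'rV[R]_(1 + n) -> R) t :
  gauss_decay g -> gauss_decay (fun v => g (row_cons t v)).
Proof.
by move=> [a [C [a0 gC]]]; exists a, C; split=> //;
  exact: gauss_bounded_row_cons_le.
Qed.

(** One unfolding of the iterated integral with real values; the inductions on the dimension below
    all go through it. *)
Lemma rint_recl n (g : 'rV[R]_(1 + n) -> R)
    (G := fun t => rint (fun v => g (row_cons t v))) : gauss_decay g ->
  [/\ continuous G, mu.-integrable setT (EFin \o G) & rint g = \int[mu]_t G t].
Proof.
move=> gd; have [a [C [a0 gC]]] := gd.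
have [IHb IHc] := iint_gauss_bounded n a0.
have cG : continuous G.
  apply: (IHc C (fun t v => g (row_cons t v))).
    move=> p; apply: continuous_comp; first exact: continuous_row_cons.
    by have [cg _] := gC; exact: cg.
  by move=> t; exact: gauss_bounded_row_cons_le.
split=> //.
  apply: (@integrable_gauss_bounded _ a (C * gauss_mass a ^+ n)) => // t.
  by rewrite mulrAC; have [_] := IHb _ _ (gauss_bounded_row_cons t gC).
congr fine; apply: eq_integral => t _; apply: iint_rint.
exact: gauss_decay_row_cons.
Qed.

Lemma eq_rint n (g h : 'rV[R]_n -> R) : g =1 h -> rint g = rint h.
Proof. by move=> gh; congr rint; apply/funext. Qed.

(** In each coordinate the quadratic exponent absorbs the linear one, at the cost of half the
    rate. *)
Lemma gauss_decayM n b C (m g : 'rV[R]_n -> R) :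
  continuous m -> (forall y, `|m y| <= C * expR (b * \sum_i `|y 0 i|)) ->
  gauss_decay g -> gauss_decay (fun y => m y * g y).
Proof.
move=> cm mC [a [D [a0 gD]]]; have D0 := gauss_bounded_ge0 gD.
have {gD}[cg gD] := gD.
have C0 : 0 <= C.
  have /(le_trans (normr_ge0 _)) := mC 0.
  by rewrite pmulr_lge0// expR_gt0.
(* With u = |y_i|, completing the square gives b u - a u^2 <= - (a/2) u^2 + b^2/(2a); the [n]
   coordinates together produce the exponent of the constant. *)
exists (a / 2), (C * D * expR (n%:R * (b ^+ 2 / (2 * a)))); split.
  by rewrite divr_gt0.
split=> [y|y]; first by exact: continuousM (cm y) (cg y).
rewrite normrM; apply: (le_trans (ler_pM _ _ (mC y) (gD y))) => //.
rewrite mulrACA -!mulrA !ler_wpM2l// -!expRD ler_expR /sqnorm.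
(* The dimension is written as a sum of ones, so that the exponents can be compared coordinate by
   coordinate. *)
rewrite !mulr_sumr -[n in n%:R]card_ord -sum1_card natr_sum mulr_suml -!big_split/=.
apply: ler_sum => i _; rewrite -(real_normK (num_real (y 0 i))).
set u : R := `|_|.
rewrite -subr_ge0.
have -> : 1 * (b * (b / (2 * a))) + - (a / 2) * u ^+ 2 - (b * u + - a * u ^+ 2)
   = a / 2 * (u - b / a) ^+ 2 by field; rewrite gt_eqF.
by rewrite mulr_ge0 ?sqr_ge0// divr_ge0// ltW.
Qed.

Lemma gauss_decayZ n c (g : 'rV[R]_n -> R) :
  gauss_decay g -> gauss_decay (fun y => c * g y).
Proof.
apply: (@gauss_decayM _ 0 `|c| (cst c)); first exact: cst_continuous.
by move=> y; rewrite mul0r expR0 mulr1.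
Qed.

(** The smaller rate serves both functions, and the nonnegative constants add up. *)
Lemma gauss_decayD n (g h : 'rV[R]_n -> R) :
  gauss_decay g -> gauss_decay h -> gauss_decay (fun y => g y + h y).
Proof.
move=> [a [C [a0 gC]]] [b [D [b0 hD]]].
have C0 := gauss_bounded_ge0 gC; have D0 := gauss_bounded_ge0 hD.
have {gC}[cg gC] := gC; have {hD}[ch hD] := hD.
exists (Num.min a b), (C + D); split; first by rewrite lt_min a0.
split=> [y|y]; first by exact: continuousD (cg y) (ch y).
apply: (le_trans (ler_normD _ _)); rewrite mulrDl; apply: lerD.
  apply: (le_trans (gC y));
    rewrite ler_wpM2l// ler_expR ler_wpM2r ?sqnorm_ge0//.
  by rewrite lerN2 ge_min lexx.
apply: (le_trans (hD y)); rewrite ler_wpM2l// ler_expR ler_wpM2r ?sqnorm_ge0//.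
by rewrite lerN2 ge_min lexx orbT.
Qed.

Lemma rintZ n c (g : 'rV[R]_n -> R) : gauss_decay g ->
  rint (fun y => c * g y) = c * rint g.
Proof.
elim: n g => [//|n IH] g gd; have [_ iG ->] := rint_recl gd.
have [_ _ ->] := rint_recl (gauss_decayZ c gd).
rewrite -RintegralZl//; apply: eq_Rintegral => t _.
by rewrite IH//; exact: gauss_decay_row_cons.
Qed.

Lemma rintD n (g h : 'rV[R]_n -> R) : gauss_decay g -> gauss_decay h ->
  rint (fun y => g y + h y) = rint g + rint h.
Proof.
elim: n g h => [//|n IH] g h gd hd.
have [_ iG ->] := rint_recl gd; have [_ iH ->] := rint_recl hd.
have [_ _ ->] := rint_recl (gauss_decayD gd hd).
rewrite -RintegralD//; apply: eq_Rintegral => t _.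
by rewrite IH//; exact: gauss_decay_row_cons.
Qed.

(** The iterated integral is nonnegative in the extended reals, and [fine] preserves this even at
    [+oo], which it sends to 0. *)
Lemma rint_ge0 n (g : 'rV[R]_n -> R) : (forall y, 0 <= g y) -> 0 <= rint g.
Proof.
move=> g0; apply: fine_ge0; elim: n g g0 => [|n IH] g g0 /=;
  first by rewrite lee_fin.
by apply: integral_ge0 => t _; exact: IH.
Qed.

Lemma gauss_decayB n (g h : 'rV[R]_n -> R) :
  gauss_decay g -> gauss_decay h -> gauss_decay (fun y => g y - h y).
Proof.
move=> gd hd; rewrite (_ : (fun _ => _) = (fun y => g y + -1 * h y)).
  by apply: gauss_decayD => //; exact: gauss_decayZ.
by apply/funext => y; rewrite mulN1r.
Qed.

Lemma rintB n (g h : 'rV[R]_n -> R) : gauss_decay g -> gauss_decay h ->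
  rint (fun y => g y - h y) = rint g - rint h.
Proof.
move=> gd hd; rewrite -[in RHS]mulN1r -rintZ// -rintD//;
  last exact: gauss_decayZ.
by apply: eq_rint => y; rewrite mulN1r.
Qed.

Lemma le_rint n (g h : 'rV[R]_n -> R) : gauss_decay g -> gauss_decay h ->
  (forall y, g y <= h y) -> rint g <= rint h.
Proof.
move=> gd hd gh; rewrite -subr_ge0 -rintB//.
by apply: rint_ge0 => y; rewrite subr_ge0.
Qed.

Lemma ler_norm_rint n (g h : 'rV[R]_n -> R) : gauss_decay g -> gauss_decay h ->
  (forall y, `|g y| <= h y) -> `|rint g| <= rint h.
Proof.
move=> gd hd gh; rewrite ler_norml; apply/andP; split.
  rewrite lerNl -mulN1r -rintZ//; apply: le_rint => //;
    first exact: gauss_decayZ.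
  by move=> y; rewrite mulN1r (le_trans _ (gh y))// -normrN ler_norm.
by apply: le_rint => // y; rewrite (le_trans _ (gh y))// ler_norm.
Qed.

(** On the unit interval [G] attains a positive minimum, which bounds the integral from below. *)
Lemma Rintegral_gt0_continuous (G : R -> R) : continuous G ->
  mu.-integrable setT (EFin \o G) -> (forall t, 0 < G t) -> 0 < \int[mu]_t G t.
Proof.
move=> cG iG G0.
have [c _ Gc] := EVT_min ler01 (continuous_subspaceT cG).
rewrite -lte_fin /Rintegral fineK; last exact: integrable_fin_num.
apply: (@lt_le_trans _ _ (\int[mu]_(t in `[0%R, 1%R]) (G c)%:E)%E).
  by rewrite integral_cst//= lebesgue_measure_itv/= lte01 oppr0 adde0 mule1 lte_fin.
apply: (@le_trans _ _ (\int[mu]_(t in `[0%R, 1%R]) (G t)%:E)%E).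
  apply: ge0_le_integral => //=.
  - by move=> t _; rewrite lee_fin ltW.
  - by apply/measurable_EFinP; apply: measurable_funTS;
    exact: continuous_measurable_fun.
apply: ge0_subset_integral => //=.
  by apply/measurable_EFinP; exact: continuous_measurable_fun.
by move=> t _; rewrite lee_fin ltW.
Qed.

Lemma rint_gt0 n (g : 'rV[R]_n -> R) : gauss_decay g ->
  (forall y, 0 < g y) -> 0 < rint g.
Proof.
elim: n g => [g _ g0|n IH g gd g0]; first exact: g0.
have [cG iG ->] := rint_recl gd; apply: Rintegral_gt0_continuous => // t.
by apply: IH => //; exact: gauss_decay_row_cons.
Qed.

End GaussDecay.

(** * Quadratic remainders and differentiability of Laplace transforms *)

Section Laplace.
Context {R : realType}.
Implicit Types (n : nat) (C c theta q : R).

(** A remainder of order |h|^2 is o(|h|). The bound is asked only for |h| <= 1, because the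
    exponential remainders met later are uniform only on bounded sets of increments. *)
Lemma is_diff_quadratic (V W : normedModType R) (F : V -> W) (x : V)
    (l : {linear V -> W}) C : continuous l ->
  (forall h, `|h| <= 1 -> `|F (h + x) - F x - l h| <= C * `|h| ^+ 2) ->
  is_diff x F l.
Proof.
move=> lc Fl.
have E : F \o shift x = cst (F x) + l +o_ 0 id.
  apply/eqaddoP => _/posnumP[e]; near=> h.
  have h1 : `|h| <= 1 by near: h; apply: nbhs0_le.
  rewrite /= !fctE /= opprD addrA; apply: (le_trans (Fl h h1)).
  rewrite expr2 mulrA ler_wpM2r//.
  (* [|C| + 1] is positive whatever the sign of [C], so that [e / (|C| + 1)] is a valid radius. *)
  apply: (@le_trans _ _ ((`|C| + 1) * `|h|)).
    by rewrite ler_wpM2r// (le_trans (ler_norm _))// lerDl.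
  rewrite mulrC -ler_pdivlMr; last by rewrite ltr_wpDl.
  by near: h; apply: nbhs0_le; rewrite divr_gt0// ltr_wpDl.
have dl := diff_unique lc E.
by split=> //; apply/diff_locallyP; rewrite dl.
Unshelve. all: by end_near. Qed.

Lemma continuous_sum_rV n (f : 'I_n -> 'rV[R]_n -> R) :
  (forall i, continuous (f i)) -> continuous (fun y => \sum_i f i y).
Proof. by move=> cf; apply: continuous_big => // p; exact: add_continuous. Qed.

Lemma is_diff_rV_quadratic n (F : 'rV[R]_n -> R) (x : 'rV[R]_n)
    (c : 'I_n -> R) C :
  (forall h, `|h| <= 1 ->
    `|F (h + x) - F x - \sum_i h 0 i * c i| <= C * `|h| ^+ 2) ->
  is_diff x F (fun h => \sum_i h 0 i * c i).
Proof.
move=> Fl; set l := fun h => _.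
have ll : linear l.
  move=> k u v; rewrite /l scaler_sumr -big_split/=; apply: eq_bigr => i _.
  by rewrite !mxE mulrDl -mulrA.
pose lM := GRing.isLinear.Build _ _ _ _ _ ll.
pose lL : {linear 'rV[R]_n -> R} := HB.pack l lM.
apply: (@is_diff_quadratic _ _ F x lL C) => //.
apply: continuous_sum_rV => i y.
by apply: continuousM; [exact: coord_continuous|exact: cst_continuous].
Qed.

(** Everything follows from 1 + q <= e^q at [q] and [- q]: the latter gives e^q - 1 - q <= q (e^q -
    1), and then e^q - 1 is at most q e^q, or at least q when q is negative. *)
Lemma expR_sub_le q : `|expR q - 1 - q| <= q ^+ 2 * expR `|q|.
Proof.
have e1 := expR_ge1Dx q; have e2 := expR_ge1Dx (- q).
have ep := expR_gt0 q.
have eN : expR (- q) * expR q = 1 by rewrite -expRD addNr expR0.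
rewrite ger0_norm; last by lra.
have le1 : expR q - 1 - q <= q * (expR q - 1).
  have : (1 - q) * expR q <= expR (- q) * expR q by rewrite ler_wpM2r// ltW.
  by rewrite eN; lra.
apply: (le_trans le1); have [q0|q0] := leP 0 q.
  rewrite ger0_norm// expr2 -mulrA ler_wpM2l//.
  have : (1 - q) * expR q <= expR (- q) * expR q by rewrite ler_wpM2r// ltW.
  by rewrite eN; lra.
apply: (@le_trans _ _ (q ^+ 2)); first by nra.
by rewrite ler_peMr ?sqr_ge0// -expR0 ler_expR.
Qed.

Definition dot n (x y : 'rV[R]_n) : R := \sum_i x 0 i * y 0 i.
(** The dual of the maximum norm carried by ['rV[R]_n]; being a sum over coordinates, it fits the
    hypothesis of [gauss_decayM]. *)
Definition l1norm n (y : 'rV[R]_n) : R := \sum_i `|y 0 i|.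

Lemma l1norm_ge0 n (y : 'rV[R]_n) : 0 <= l1norm y.
Proof. exact: sumr_ge0. Qed.

Lemma dotDl n (x h y : 'rV[R]_n) : dot (h + x) y = dot h y + dot x y.
Proof.
by rewrite /dot -big_split/=; apply: eq_bigr => i _; rewrite mxE mulrDl.
Qed.

Lemma ler_coord_norm n (h : 'rV[R]_n) i : `|h 0 i| <= `|h|.
Proof.
rewrite [leRHS]/Num.norm/= mx_normrE.
by apply/bigmax_geP; right; exists (0, i).
Qed.

Lemma ler_norm_dot n (x y : 'rV[R]_n) : `|dot x y| <= `|x| * l1norm y.
Proof.
rewrite (le_trans (ler_norm_sum _ _ _))// mulr_sumr ler_sum// => i _.
by rewrite normrM ler_wpM2r// ler_coord_norm.
Qed.

Lemma ler_coord_l1norm n (y : 'rV[R]_n) i : `|y 0 i| <= l1norm y.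
Proof. by rewrite /l1norm (bigD1 i)//= lerDl sumr_ge0. Qed.

Lemma continuous_dot n (x : 'rV[R]_n) : continuous (dot x).
Proof.
apply: continuous_sum_rV => i y.
by apply: continuousM; [exact: cst_continuous|exact: coord_continuous].
Qed.

Lemma continuous_l1norm n : continuous (@l1norm n).
Proof.
apply: continuous_sum_rV => i y; apply: continuous_comp;
  first exact: coord_continuous.
exact: norm_continuous.
Qed.

Lemma gauss_decay_norm n (g : 'rV[R]_n -> R) :
  gauss_decay g -> gauss_decay (fun y => `|g y|).
Proof.
move=> [a [C [a0 [cg gC]]]]; exists a, C; split=> //; split=> y.
  by apply: continuous_comp; [exact: cg|exact: norm_continuous].
by rewrite normr_id.
Qed.

Lemma gauss_decay_coord n (g : 'rV[R]_n -> R) i :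
  gauss_decay g -> gauss_decay (fun y => y 0 i * g y).
Proof.
apply: (@gauss_decayM _ _ 1 1 (fun y => y 0 i)); first exact: coord_continuous.
move=> y; rewrite !mul1r (le_trans (ler_coord_l1norm _ _))//.
by rewrite (le_trans _ (expR_ge1Dx _))// lerDr.
Qed.

Lemma gauss_decay_l1norm n (g : 'rV[R]_n -> R) :
  gauss_decay g -> gauss_decay (fun y => l1norm y * g y).
Proof.
apply: (@gauss_decayM _ _ 1 1 (@l1norm n)); first exact: continuous_l1norm.
move=> y; rewrite !mul1r ger0_norm ?l1norm_ge0//.
by rewrite (le_trans _ (expR_ge1Dx _))// lerDr.
Qed.

Lemma gauss_decay_expR n (m g : 'rV[R]_n -> R) b : continuous m ->
  (forall y, m y <= b * l1norm y) ->
  gauss_decay g -> gauss_decay (fun y => expR (m y) * g y).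
Proof.
move=> cm mb; apply: (@gauss_decayM _ _ b 1 (fun y => expR (m y))).
  by move=> y; apply: continuous_comp; [exact: cm|exact: continuous_expR].
by move=> y; rewrite mul1r ger0_norm ?expR_ge0// ler_expR.
Qed.

Lemma gauss_decay0 n : gauss_decay (fun _ : 'rV[R]_n => 0).
Proof.
exists 1, 0; split=> //; split=> [y|y]; first exact: cst_continuous.
by rewrite normr0 mul0r.
Qed.

Lemma gauss_decay_sum n (I : Type) (r : seq I) (g : I -> 'rV[R]_n -> R) :
  (forall i, gauss_decay (g i)) -> gauss_decay (fun y => \sum_(i <- r) g i y).
Proof.
move=> gd; elim: r => [|i r IH].
  rewrite (_ : (fun _ => _) = (fun=> 0)); first exact: gauss_decay0.
  by apply/funext => y; rewrite big_nil.
rewrite (_ : (fun _ => _) = (fun y => g i y + \sum_(j <- r) g j y)).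
  exact: gauss_decayD.
by apply/funext => y; rewrite big_cons.
Qed.

Lemma rint_sum n (I : Type) (r : seq I) (g : I -> 'rV[R]_n -> R) :
  (forall i, gauss_decay (g i)) ->
  rint (fun y => \sum_(i <- r) g i y) = \sum_(i <- r) rint (g i).
Proof.
move=> gd; elim: r => [|i r IH].
  rewrite big_nil -[RHS](mul0r (rint (fun _ : 'rV[R]_n => 0))).
  rewrite -rintZ; last exact: gauss_decay0.
  by apply: eq_rint => y; rewrite big_nil mul0r.
rewrite big_cons -IH -rintD//; last exact: gauss_decay_sum.
by apply: eq_rint => y; rewrite big_cons.
Qed.

(** The two-sided Laplace transform of [g] at [- theta *: x] in the usual sign convention; [theta]
    will be the inverse of [lam * del]. *)
Definition laplace n theta (g : 'rV[R]_n -> R) (x : 'rV[R]_n) : R :=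
  rint (fun y => expR (theta * dot x y) * g y).

Lemma gauss_decay_laplace n theta (g : 'rV[R]_n -> R) (x : 'rV[R]_n) :
  gauss_decay g -> gauss_decay (fun y => expR (theta * dot x y) * g y).
Proof.
apply: (@gauss_decay_expR _ (fun y => theta * dot x y) _ (`|theta| * `|x|)).
  by move=> y; apply: continuousM;
    [exact: cst_continuous|exact: continuous_dot].
move=> y; rewrite (le_trans (ler_norm _))// normrM -mulrA ler_wpM2l//.
exact: ler_norm_dot.
Qed.

Lemma laplaceD n theta (g k : 'rV[R]_n -> R) x :
  gauss_decay g -> gauss_decay k ->
  laplace theta (fun y => g y + k y) x = laplace theta g x + laplace theta k x.
Proof.
move=> gd kd; rewrite /laplace -rintD; [|exact: gauss_decay_laplace..].
by apply: eq_rint => y; rewrite mulrDr.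
Qed.

Lemma laplaceZ n theta c (g : 'rV[R]_n -> R) x : gauss_decay g ->
  laplace theta (fun y => c * g y) x = c * laplace theta g x.
Proof.
move=> gd; rewrite /laplace -rintZ; last exact: gauss_decay_laplace.
by apply: eq_rint => y; rewrite mulrCA.
Qed.

Lemma laplace_sum n theta (I : Type) (r : seq I) (g : I -> 'rV[R]_n -> R) x :
  (forall i, gauss_decay (g i)) ->
  laplace theta (fun y => \sum_(i <- r) g i y) x =
  \sum_(i <- r) laplace theta (g i) x.
Proof.
move=> gd; rewrite /laplace -rint_sum; last by move=> i;
  exact: gauss_decay_laplace.
by apply: eq_rint => y; rewrite mulr_sumr.
Qed.

Lemma laplace_gt0 n theta (g : 'rV[R]_n -> R) x : gauss_decay g ->
  (forall y, 0 < g y) -> 0 < laplace theta g x.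
Proof.
move=> gd g0; apply: rint_gt0; first exact: gauss_decay_laplace.
by move=> y; rewrite mulr_gt0// expR_gt0.
Qed.

Lemma is_diff_laplace n theta (g : 'rV[R]_n -> R) (x : 'rV[R]_n) :
  gauss_decay g ->
  is_diff x (laplace theta g)
    (fun h => \sum_i h 0 i * (theta * laplace theta (fun y => y 0 i * g y) x)).
Proof.
move=> gd.
(* [B] dominates the pointwise remainder divided by |h|^2: [expR_sub_le] yields q^2 e^|q| with |q|
   <= |h| |theta| [l1norm y], and |h| <= 1 removes [h] from the exponent. The integral of [B] is the
   quadratic constant. *)
pose B y := theta ^+ 2 * (l1norm y * (l1norm y * (expR (`|theta| * l1norm y) *
  (expR (theta * dot x y) * `|g y|)))).
have Bd : gauss_decay B.
  apply/gauss_decayZ/gauss_decay_l1norm/gauss_decay_l1norm.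
  apply: (@gauss_decay_expR _ (fun y => `|theta| * l1norm y) _ `|theta|) => //.
    move=> y; apply: (@continuous_comp _ _ _ (@l1norm n) ( *%R `|theta|)).
      exact: continuous_l1norm.
    exact: mulrl_continuous.
  exact/gauss_decay_laplace/gauss_decay_norm.
apply: (@is_diff_rV_quadratic _ _ _ _ (rint B)) => h h1.
have gid i : gauss_decay (fun y => y 0 i * g y) by exact: gauss_decay_coord.
(* The candidate differential becomes a single integral, so that the whole remainder can be
   estimated under one integral sign. *)
have -> : \sum_i h 0 i * (theta * laplace theta (fun y => y 0 i * g y) x) =
    rint (fun y =>
      \sum_i h 0 i * (theta * (expR (theta * dot x y) * (y 0 i * g y)))).
  rewrite rint_sum => [|i]; last first.
    by apply/gauss_decayZ/gauss_decayZ; exact: gauss_decay_laplace.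
  apply: eq_bigr => i _; rewrite rintZ; last first.
    by apply: gauss_decayZ; exact: gauss_decay_laplace.
  by rewrite rintZ//; exact: gauss_decay_laplace.
have sd : gauss_decay (fun y =>
    \sum_i h 0 i * (theta * (expR (theta * dot x y) * (y 0 i * g y)))).
  apply: gauss_decay_sum => i.
  by apply/gauss_decayZ/gauss_decayZ; exact: gauss_decay_laplace.
rewrite /laplace -rintB; [|exact: gauss_decay_laplace..].
rewrite -rintB//; last by apply: gauss_decayB; exact: gauss_decay_laplace.
rewrite mulrC -rintZ//; apply: ler_norm_rint.
- by do 2?apply: gauss_decayB => //; exact: gauss_decay_laplace.
- exact: gauss_decayZ.
move=> y; pose q := theta * dot h y.
have -> : \sum_i h 0 i * (theta * (expR (theta * dot x y) * (y 0 i * g y))) =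
    q * (expR (theta * dot x y) * g y).
  have -> : q = \sum_i theta * (h 0 i * y 0 i) by rewrite /q /dot mulr_sumr.
  by rewrite mulr_suml; apply: eq_bigr => i _; ring.
rewrite dotDl mulrDr expRD -/q.
have -> : expR q * expR (theta * dot x y) * g y - expR (theta * dot x y) * g y -
    q * (expR (theta * dot x y) * g y) =
    (expR q - 1 - q) * (expR (theta * dot x y) * g y) by ring.
have qle : `|q| <= `|h| * (`|theta| * l1norm y).
  by rewrite /q normrM mulrCA ler_wpM2l// ler_norm_dot.
rewrite normrM; apply: (@le_trans _ _ ((`|h| * (`|theta| * l1norm y)) ^+ 2 *
    expR (`|theta| * l1norm y) * `|expR (theta * dot x y) * g y|)).
  rewrite ler_wpM2r//; apply: (le_trans (expR_sub_le q)); apply: ler_pM => //.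
  - exact: sqr_ge0.
  - by rewrite -real_normK ?num_real// lerXn2r ?nnegrE// ?mulr_ge0// l1norm_ge0.
  - by rewrite ler_expR (le_trans qle)// ler_piMl// mulr_ge0// l1norm_ge0.
rewrite normrM (ger0_norm (expR_ge0 _)) /B -(real_normK (num_real theta)).
rewrite le_eqVlt; apply/orP; left; apply/eqP; ring.
Qed.

End Laplace.

(** * Differentials of coordinates, squared norm, logarithm and quotient; Jacobian entries *)

Section Calculus.
Context {R : realType}.
Implicit Types (n : nat).

Lemma sum_delta n (c : 'I_n -> R) i :
  \sum_j (delta_mx 0 i : 'rV[R]_n) 0 j * c j = c i.
Proof.
rewrite (bigD1 i)//= big1 ?addr0 => [|j ji]; first by rewrite mxE !eqxx mul1r.
by rewrite mxE (negbTE ji) mul0r.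
Qed.

Lemma is_diff_coord n (x : 'rV[R]_n) i :
  is_diff x (fun z : 'rV[R]_n => z 0 i) (fun h => h 0 i).
Proof.
have := @is_diff_rV_quadratic R n (fun z => z 0 i) x (fun j => (j == i)%:R) 0.
have -> : (fun h : 'rV[R]_n => \sum_j h 0 j * (j == i)%:R) = fun h => h 0 i.
  apply/funext => h;
    rewrite (bigD1 i)//= eqxx mulr1 big1 ?addr0// => j /negbTE ->.
  by rewrite mulr0.
apply=> h _; rewrite mxE addrK (bigD1 i)//= eqxx mulr1 big1.
  by rewrite addr0 subrr normr0 mul0r.
by move=> j /negbTE ->; rewrite mulr0.
Qed.

Lemma sqnormD n (x h : 'rV[R]_n) :
  sqnorm (h + x) = sqnorm h + 2 * dot x h + sqnorm x.
Proof.
rewrite /sqnorm /dot mulr_sumr -!big_split/=; apply: eq_bigr => i _.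
by rewrite !mxE; ring.
Qed.

(** The remainder is exactly [sqnorm h], at most [n] times the square of the maximum norm. *)
Lemma is_diff_sqnorm n (x : 'rV[R]_n) :
  is_diff x (@sqnorm R n) (fun h => \sum_i h 0 i * (2 * x 0 i)).
Proof.
apply: (@is_diff_rV_quadratic _ _ _ _ _ n%:R) => h _.
rewrite sqnormD addrK.
have -> : \sum_i h 0 i * (2 * x 0 i) = 2 * dot x h.
  by rewrite /dot mulr_sumr; apply: eq_bigr => i _;
    rewrite mulrCA [_ * x _ _]mulrC.
rewrite addrK ger0_norm ?sqnorm_ge0//
  -[n in n%:R]card_ord -sum1_card natr_sum mulr_suml.
apply: ler_sum => i _; rewrite mul1r -[leLHS]real_normK ?num_real//.
by rewrite lerXn2r ?nnegrE// ler_coord_norm.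
Qed.

Lemma is_diff_ln (V : normedModType R) (M dM : V -> R) (x : V) : 0 < M x ->
  is_diff x M dM -> is_diff x (fun z => ln (M z)) (fun h => dM h / M x).
Proof.
move=> M0 dMx; have := is_derive1_ln M0 => -[dl lE].
have ld : is_diff (M x) (@ln R) (fun h => h / M x).
  split; first exact/derivable1_diffP.
  by rewrite deriv1E// derive1E lE.
exact: (is_diff_comp dMx ld).
Qed.

Lemma is_diff_div (V : normedModType R) (N M dN dM : V -> R) (x : V) :
  M x != 0 ->
  is_diff x N dN -> is_diff x M dM ->
  is_diff x (fun z => N z / M z) (fun h => dN h / M x - N x * dM h / M x ^+ 2).
Proof.
move=> M0 dNx dMx.
have dV : is_diff x (fun z => (M z)^-1) (- (M x) ^- 2 \*: dM).
  split; first by apply: differentiableV => //; exact: ex_diff.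
  by rewrite diffV// diff_val.
apply: (is_diff_eq (is_diffM dNx dV)).
by apply/funext => h /=; rewrite !fctE/= /GRing.scale/=; field.
Qed.

Lemma differentiable_rV n (V : normedModType R) (F : V -> 'rV[R]_n) (x : V) :
  (forall i, differentiable (fun z => F z 0 i) x) -> differentiable F x.
Proof.
move=> dF; rewrite (_ : F = \sum_i (fun z => F z 0 i *: delta_mx 0 i)).
  by apply: differentiable_sum => i; exact: differentiableZl.
by apply/funext => z; rewrite fct_sumE [LHS]row_sum_delta.
Qed.

(** Row vectors multiply the Jacobian from the left, so the row index is the direction of
    differentiation and the column index the component. *)
Lemma jacobianE n m (F : 'rV[R]_n -> 'rV[R]_m)
    (dF : 'I_m -> 'rV[R]_n -> R) x i j :
  (forall k, is_diff x (fun z => F z 0 k) (dF k)) ->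
  jacobian F x i j = dF j (delta_mx 0 i).
Proof.
move=> dFx.
have dF' : differentiable F x by apply: differentiable_rV => k; exact: ex_diff.
have := deriveEjacobian (delta_mx 0 i) dF';
  rewrite -rowE => /(congr1 (fun r : 'rV_m => r 0 j)).
rewrite mxE => <-; rewrite derive_mx ?mxE; last exact: diff_derivable.
by rewrite deriveE ?diff_val//; exact: ex_diff.
Qed.

End Calculus.

(** * The soft Moreau envelope: gradient, covariance and Hessian *)

Section SoftMoreau.
Context {R : realType} (d : nat) (lam del : R) (f : 'rV[R]_d -> R).
Context (lam0 : 0 < lam) (del0 : 0 < del) (cf : continuous f).
Context (fmin : exists x0 : 'rV[R]_d, forall y, f x0 <= f y).

Let s := lam * del.
Let s0 : 0 < s. Proof. exact: mulr_gt0. Qed.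

(** The part of the density of mu_x that is left once the factors involving [x] are split off. *)
Definition gibbs_kernel (y : 'rV[R]_d) : R :=
  expR (- f y / del) * expR (- sqnorm y / (2 * s)).

(** [M], [N] and [N2] are the mass and the first and second moments of mu_x, up to a common factor
    depending on [x]; division by [M x] normalizes them. *)
Let L (g : 'rV[R]_d -> R) := laplace s^-1 (fun y => g y * gibbs_kernel y).
Let M := laplace s^-1 gibbs_kernel.
Let N i := laplace s^-1 (fun y => y 0 i * gibbs_kernel y).
Let N2 i j := laplace s^-1 (fun y => y 0 i * (y 0 j * gibbs_kernel y)).

Lemma gibbs_kernel_gt0 y : 0 < gibbs_kernel y.
Proof. by rewrite mulr_gt0 ?expR_gt0. Qed.

(** The minimum of [f] bounds the first factor by a constant, and the second is the Gaussian
    itself. *)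
Lemma gauss_decay_gibbs_kernel : gauss_decay gibbs_kernel.
Proof.
have [x0 fx0] := fmin.
exists (2 * s)^-1, (expR (- f x0 / del)); split;
  first by rewrite invr_gt0 mulr_gt0.
split=> [y|y].
  apply: (@continuousM _ _ (fun y => expR (- f y / del))
    (fun y => expR (- sqnorm y / (2 * s)))).
    apply: (@continuous_comp _ _ _ (fun y => - f y / del));
      last exact: continuous_expR.
    apply: (@continuousM _ _ (fun y => - f y)); last exact: cst_continuous.
    by apply: continuousN; exact: cf.
  apply: (@continuous_comp _ _ _ (fun y => - sqnorm y / (2 * s)));
    last exact: continuous_expR.
  apply: (@continuousM _ _ (fun y => - sqnorm y)); last exact: cst_continuous.
  apply: continuousN; apply: differentiable_continuous.
  by have [] := is_diff_sqnorm y.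
rewrite (ger0_norm (ltW (gibbs_kernel_gt0 y))) /gibbs_kernel; apply: ler_pM;
  rewrite ?expR_ge0//.
  by rewrite ler_expR ler_pM2r ?invr_gt0// lerN2.
by rewrite ler_expR !mulNr mulrC.
Qed.

Let kd := gauss_decay_gibbs_kernel.

Lemma laplace_gibbs_kernel_gt0 x : 0 < M x.
Proof. by apply: laplace_gt0 => //; exact: gibbs_kernel_gt0. Qed.

Lemma gauss_factor (x y : 'rV[R]_d) :
  expR (- sqnorm (y - x) / (2 * s)) =
  expR (- sqnorm x / (2 * s)) *
    (expR (s^-1 * dot x y) * expR (- sqnorm y / (2 * s))).
Proof.
rewrite sqnormD -!expRD; congr expR.
have -> : dot (- x) y = - dot x y.
  by rewrite /dot -sumrN; apply: eq_bigr => i _; rewrite mxE mulNr.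
have -> : sqnorm (- x) = sqnorm x.
  by apply: eq_bigr => i _; rewrite mxE sqrrN.
by field; rewrite gt_eqF.
Qed.

Let c0 := (Num.sqrt (2 * pi * s) ^+ d)^-1.
Let c0_gt0 : 0 < c0.
Proof. by rewrite invr_gt0 exprn_gt0// sqrtr_gt0 !mulr_gt0// pi_gt0. Qed.

(** The prefactor is the same for every [g] and cancels in ratios; [k] lets the caller choose the
    form of the integrand. *)
Lemma gauss_expect_laplace (g k : 'rV[R]_d -> R) x :
  gauss_decay k -> (forall y, g y * expR (- sqnorm y / (2 * s)) = k y) ->
  gauss_expect lam del x g =
  c0 * expR (- sqnorm x / (2 * s)) * laplace s^-1 k x.
Proof.
move=> dk gk; rewrite /gauss_expect /laplace -rintZ;
  last exact: gauss_decay_laplace.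
apply: eq_rint => y; rewrite /gauss_dens -/s -/c0 gauss_factor -gk; ring.
Qed.

Lemma zprox_laplace x i : zprox f lam del x 0 i = N i x / M x.
Proof.
rewrite mxE (@gauss_expect_laplace _ (fun y => y 0 i * gibbs_kernel y));
  first last.
- by move=> y; rewrite /gibbs_kernel mulrA.
- exact: gauss_decay_coord.
rewrite (@gauss_expect_laplace _ gibbs_kernel)//.
have := laplace_gibbs_kernel_gt0 x; rewrite -/M => Mx.
rewrite -/(N i x) -/(M x); field.
by rewrite !gt_eqF ?expR_gt0.
Qed.

Lemma soft_moreauE : soft_moreau f lam del =
  fun x => - del * (ln c0 - sqnorm x / (2 * s) + ln (M x)).
Proof.
apply/funext => x;
  rewrite /soft_moreau (@gauss_expect_laplace _ gibbs_kernel)//.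
rewrite -/(M x) !lnM ?posrE ?mulr_gt0 ?expR_gt0 ?laplace_gibbs_kernel_gt0//.
by rewrite expRK (mulNr (sqnorm x)).
Qed.

(** As del / s = 1 / lam, the quadratic term contributes x / lam and [ln (M x)] contributes minus
    the mean over lam: the gradient is (x - zprox) / lam. *)
Lemma is_diff_soft_moreau x : is_diff x (soft_moreau f lam del)
  (fun h => \sum_i h 0 i * (lam^-1 * (x 0 i - N i x / M x))).
Proof.
rewrite soft_moreauE.
have dM := is_diff_ln (laplace_gibbs_kernel_gt0 x) (is_diff_laplace s^-1 x kd).
have dS := is_diffZ (- (2 * s)^-1) (is_diff_sqnorm x).
have dF := is_diffZ (- del) (is_diffD (is_diffD (is_diff_cst (ln c0) x) dS) dM).
have -> : (fun z => - del * (ln c0 - sqnorm z / (2 * s) + ln (M z))) =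
    - del *: (cst (ln c0) + (- (2 * s)^-1) *: @sqnorm R d + (fun z => ln (M z))).
  by apply/funext => z; rewrite !fctE /GRing.scale/=; ring.
apply: (is_diff_eq dF); apply/funext => h; rewrite !fctE /GRing.scale/=.
rewrite add0r mulr_sumr mulr_suml -big_split mulr_sumr;
  apply: eq_bigr => i _ /=.
have := laplace_gibbs_kernel_gt0 x; rewrite -/M -/(N i x) => Mx; rewrite /s;
  field.
by rewrite !gt_eqF.
Qed.

Lemma grad_soft_moreauE : grad (soft_moreau f lam del) =
  fun x => \row_i (lam^-1 * (x 0 i - N i x / M x)).
Proof.
apply/funext => x; apply/rowP => i; rewrite !mxE.
have dF := is_diff_soft_moreau x.
by rewrite deriveE ?diff_val ?sum_delta//; exact: ex_diff.
Qed.

(** Quotient rule for the mean [N i / M]: along coordinate [j], [M] yields [N j] and [N i] yields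
    [N2 j i], each divided by [s]. *)
Lemma is_diff_grad_soft_moreau x i :
  is_diff x (fun z => grad (soft_moreau f lam del) z 0 i)
   (fun h => lam^-1 * (h 0 i -
      ((\sum_j h 0 j * (s^-1 * N2 j i x)) / M x -
        N i x * (\sum_j h 0 j * (s^-1 * N j x)) / M x ^+ 2))).
Proof.
rewrite grad_soft_moreauE.
have dM := is_diff_laplace s^-1 x kd.
have dN := is_diff_laplace s^-1 x (gauss_decay_coord i kd).
have dq := is_diff_div (lt0r_neq0 (laplace_gibbs_kernel_gt0 x)) dN dM.
have dF := is_diffZ lam^-1 (is_diffB (is_diff_coord x i) dq).
rewrite (_ : (fun z => _) =
    lam^-1 *: ((fun z : 'rV[R]_d => z 0 i) - (fun z => N i z / M z))).
  exact: is_diff_eq dF _.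
by apply/funext => z; rewrite !mxE.
Qed.

(** The factor exp(-|x|^2/(2s)) cancels between numerator and normalization, the latter being the
    case of the constant function 1. *)
Lemma mu_int_laplace (g : 'rV[R]_d -> R) x :
  gauss_decay (fun y => g y * gibbs_kernel y) ->
  mu_int f lam del x g = L g x / M x.
Proof.
move=> gd; rewrite /mu_int.
have E (h k : 'rV[R]_d -> R) : gauss_decay k ->
    (forall y, h y * gibbs_kernel y = k y) ->
    fine (iint (fun y => (h y * mu_dens f lam del x y)%:E)) =
    expR (- sqnorm x / (2 * s)) * laplace s^-1 k x.
  move=> dk hk; rewrite /laplace -rintZ; last exact: gauss_decay_laplace.
  apply: eq_rint => y;
    rewrite /mu_dens -[2 * _ * _]mulrA -/s gauss_factor -hk /gibbs_kernel; ring.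
rewrite (E g _ gd)//.
under [X in _ / fine (iint X)]funext do rewrite -[mu_dens _ _ _ _ _]mul1r.
rewrite (E (fun=> 1) gibbs_kernel)//; last by move=> y; rewrite mul1r.
rewrite -/(L g x) -/(M x); field.
by rewrite !gt_eqF ?expR_gt0 ?laplace_gibbs_kernel_gt0.
Qed.

Lemma gauss_decay_centered_prod x i j (z := zprox f lam del x) :
  gauss_decay (fun y => (y 0 i - z 0 i) * (y 0 j - z 0 j) * gibbs_kernel y).
Proof.
have shift k (g : 'rV[R]_d -> R) : gauss_decay g ->
    gauss_decay (fun y => (y 0 k - z 0 k) * g y).
  move=> gd;
    rewrite (_ : (fun _ => _) = (fun y : 'rV[R]_d => y 0 k * g y - z 0 k * g y)).
    by apply: gauss_decayB; [exact: gauss_decay_coord|exact: gauss_decayZ].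
  by apply/funext => y; rewrite mulrBl.
rewrite (_ : (fun _ => _) =
  (fun y : 'rV[R]_d => (y 0 i - z 0 i) * ((y 0 j - z 0 j) * gibbs_kernel y))).
  exact/shift/shift.
by apply/funext => y; rewrite mulrA.
Qed.

(** Covariance as second moment minus product of means: the centering point is the mean [N / M], and
    linearity expands the product. *)
Lemma SigmaE x i j : Sigma f lam del x i j =
  N2 i j x / M x - N i x * N j x / M x ^+ 2.
Proof.
rewrite mxE mu_int_laplace; last exact: (gauss_decay_centered_prod x i j).
set z := zprox f lam del x.
have di := gauss_decay_coord i kd; have dj := gauss_decay_coord j kd.
have dij := gauss_decay_coord i dj.
have -> : L (fun y : 'rV[R]_d => (y 0 i - z 0 i) * (y 0 j - z 0 j)) x =
    N2 i j x + ((- z 0 j) * N i x + ((- z 0 i) * N j x + (z 0 i * z 0 j) * M x)).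
  rewrite /L /N2 /N /M -!laplaceZ// -!laplaceD//; do ?[exact: gauss_decayZ
    |apply: gauss_decayD].
  by congr laplace; apply/funext => y; ring.
rewrite /z !zprox_laplace; field.
by rewrite gt_eqF ?laplace_gibbs_kernel_gt0.
Qed.

(** The quadratic form at [v] is the variance of <v, y> under mu_x, the integral of a square against
    a positive density. *)
Lemma psd_Sigma x : psd (Sigma f lam del x).
Proof.
move=> v; set z := zprox f lam del x.
have -> : (v *m Sigma f lam del x *m v^T) 0 0 =
    laplace s^-1 (fun y : 'rV[R]_d =>
      (\sum_i v 0 i * (y 0 i - z 0 i)) ^+ 2 * gibbs_kernel y) x / M x.
  have -> : (fun y : 'rV[R]_d =>
      (\sum_i v 0 i * (y 0 i - z 0 i)) ^+ 2 * gibbs_kernel y) =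
      (fun y : 'rV[R]_d => \sum_j \sum_i v 0 j * (v 0 i *
        ((y 0 i - z 0 i) * (y 0 j - z 0 j) * gibbs_kernel y))).
    apply/funext => y; rewrite expr2 mulr_sumr mulr_suml; apply: eq_bigr => j _.
    by rewrite !mulr_suml; apply: eq_bigr => i _; ring.
  rewrite laplace_sum => [|j]; last first.
    by apply: gauss_decay_sum => i; do 2!apply: gauss_decayZ;
      exact: (gauss_decay_centered_prod x i j).
  rewrite mxE mulr_suml; apply: eq_bigr => j _.
  rewrite laplace_sum => [|i]; last by do 2!apply: gauss_decayZ;
    exact: (gauss_decay_centered_prod x i j).
  rewrite [v^T _ _]mxE [(v *m _) _ _]mxE !mulr_suml; apply: eq_bigr => i _.
  rewrite laplaceZ; last by apply: gauss_decayZ;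
    exact: (gauss_decay_centered_prod x i j).
  rewrite laplaceZ; last exact: (gauss_decay_centered_prod x i j).
  rewrite [Sigma _ _ _ _ _ _]mxE mu_int_laplace;
    last exact: (gauss_decay_centered_prod x i j).
  by rewrite /L -/z; ring.
apply: divr_ge0; last exact/ltW/laplace_gibbs_kernel_gt0.
apply: rint_ge0 => y.
rewrite mulr_ge0 ?expR_ge0// mulr_ge0 ?sqr_ge0//.
exact: ltW (gibbs_kernel_gt0 y).
Qed.

(** The derivative of the mean is the covariance over s, and 1 / (lam s) = 1 / (lam^2 del). *)
Lemma jacobian_grad_soft_moreau x : jacobian (grad (soft_moreau f lam del)) x =
  lam^-1%:M - (lam ^+ 2 * del)^-1 *: Sigma f lam del x.
Proof.
apply/matrixP => i j; rewrite (jacobianE i j (is_diff_grad_soft_moreau x)).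
transitivity (lam^-1 *+ (i == j) - (lam ^+ 2 * del)^-1 * Sigma f lam del x i j);
  last by rewrite !mxE.
rewrite !sum_delta SigmaE mxE eqxx/= eq_sym -[_ *+ _]mulr_natr.
have Mx := laplace_gibbs_kernel_gt0 x; rewrite /s; field.
by rewrite !gt_eqF.
Qed.

End SoftMoreau.

(** * Hessian formula and convexity criterion *)

Theorem theorem12 (R : realType) (d : nat) (lam del : R) (f : 'rV[R]_d -> R) :
  (0 < d)%N -> 0 < lam -> 0 < del ->
  continuous f ->
  (exists x0 : 'rV[R]_d, forall y, f x0 <= f y) ->
  (iint (fun y => (expR (- f y / del))%:E) < +oo)%E ->
  forall x : 'rV[R]_d,
    (forall z, differentiable (soft_moreau f lam del) z) /\
    differentiable (grad (soft_moreau f lam del)) x /\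
    jacobian (grad (soft_moreau f lam del)) x =
      lam^-1%:M - (lam ^+ 2 * del)^-1 *: Sigma f lam del x /\
    psd (Sigma f lam del x) /\
    (loewner_le (Sigma f lam del x) ((lam * del)%:M) ->
       psd (jacobian (grad (soft_moreau f lam del)) x)).
Proof.
move=> _ lam0 del0 cf fmin _ x.
have JE := jacobian_grad_soft_moreau lam0 del0 cf fmin x.
split.
  by move=> z; have [] := is_diff_soft_moreau lam0 del0 cf fmin z.
split.
  apply: differentiable_rV => i.
  by have [] := is_diff_grad_soft_moreau lam0 del0 cf fmin x i.
split=> //; split; first exact: psd_Sigma.
move=> SigmaI v; rewrite JE.
(* The Hessian is a positive multiple of lam del I - Sigma, the matrix that the Loewner hypothesis
   makes positive semidefinite. *)
have -> : lam^-1%:M - (lam ^+ 2 * del)^-1 *: Sigma f lam del x =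
    (lam ^+ 2 * del)^-1 *: ((lam * del)%:M - Sigma f lam del x).
  rewrite scalerBr scale_scalar_mx; congr (_%:M - _); field.
  by rewrite !gt_eqF.
rewrite -scalemxAr -scalemxAl mxE; apply: mulr_ge0; last exact: SigmaI.
by rewrite invr_ge0 mulr_ge0 ?sqr_ge0// ltW.
Qed.
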